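(* Let $\gamma_1=\gamma_2=\gamma_3=\gamma_4=1$ and $\gamma_5=\gamma_6$, where the common value $\gamma_5=\gamma_6$ is not prescribed. Then there is a unique $\overline{x}=(x_1,\dots,x_6)\in\mathcal{X}_V$ which, for some value of $\gamma_5=\gamma_6$, is a cross configuration of the six-vortex problem with these vortex strengths and satisfies the following conditions: (1) $x_1,x_2,x_3,x_4$ are collinear; (2) the polygon with vertices $x_2,x_3,x_5,x_6$ is a square centered at the origin of the coordinate system, such that $x_2,x_3$ lie on the $y$-axis and $x_5,x_6$ lie on the $x$-axis; (3) $r_{12}=r_{34}$ and $r_{14}=2$.
   Context: Let $x=(x_1,\dots,x_6)\in(\mathbb{R}^2)^6$ with $x_i\ne x_j$ for $i\neq j$, put $r_{ij}=\|x_i-x_j\|$, let $\gamma_1,\dots,\gamma_6$ be nonzero real vortex strengths with $\gamma=\gamma_1+\cdots+\gamma_6\ne0$, and let $c=\frac1\gamma(\gamma_1x_1+\cdots+\gamma_6x_6)$. The configuration $x$ is a central configuration of the six-vortex problem if there is $\lambda\neq0$ with $\sum_{j\ne i}\gamma_j(x_j-x_i)r_{ij}^{-2}+\lambda(x_i-c)=0$ for $i=1,\dots,6$. A CC6VP (cross configuration of the six-vortex problem) is a planar (non-collinear) central configuration of the six-vortex problem such that the set $\{x_1,\dots,x_6\}$ is symmetric with respect to a line $s$ containing exactly four of the six points. The bodies are indexed so that $x_1,x_2,x_3,x_4\in s$; then $x_5,x_6$ lie on a line $l$ perpendicular to $s$. Write $x_i=(x_{i1},x_{i2})$. $\mathcal{X}_V$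 is the set of CC6VP normalized so that $c=0$, $l$ is parallel to the first coordinate axis, and (i) $x_{12}>x_{22}>x_{32}>x_{42}$; (ii) $x_{52}>x_{32}$; (iii) $x_{52}-x_{42}=1$; (iv) $x_{51}<x_{11}<x_{61}$. *)

(* Defs.v *)
From mathcomp Require Import all_boot all_order all_algebra.
From mathcomp Require Import classical_sets reals.

Set Implicit Arguments.
Unset Strict Implicit.
Unset Printing Implicit Defensive.

Import Order.TTheory GRing.Theory Num.Theory.
Local Open Scope classical_set_scope.
Local Open Scope ring_scope.

(* The norm that MathComp-Analysis puts on row vectors is the sup norm, so the
   Euclidean structure of the plane is defined here. *)
Definition dot (R : realType) (u v : 'rV[R]_2) : R := \sum_k u 0 k * v 0 k.

Definition enorm (R : realType) (u : 'rV[R]_2) : R := Num.sqrt (dot u u).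

Definition line (R : realType) (p d : 'rV[R]_2) : set 'rV[R]_2 :=
  [set q | exists t : R, q = p + t *: d].

(* Orthogonal reflection in [line p d]; meaningful when [d != 0]. *)
Definition reflection (R : realType) (p d q : 'rV[R]_2) : 'rV[R]_2 :=
  let foot := p + (dot (q - p) d / dot d d) *: d in 2 *: foot - q.

Definition collinear (R : realType) (A : set 'rV[R]_2) : Prop :=
  exists p d : 'rV[R]_2, d != 0 /\ A `<=` line p d.

(* The vertices p, q, r, s in this cyclic order form a nondegenerate square. *)
Definition square (R : realType) (p q r s : 'rV[R]_2) : Prop :=
  [/\ p != q, q - p = r - s, dot (q - p) (s - p) = 0
    & enorm (q - p) = enorm (s - p)].

(* The points of V are, in some cyclic order, the vertices of a square whose
   centre (the midpoint of a diagonal) is o. *)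
Definition square_centered_at (R : realType) (o : 'rV[R]_2)
    (V : set 'rV[R]_2) : Prop :=
  exists p q r s : 'rV[R]_2,
    [/\ V = [set p; q; r; s], square p q r s & 2^-1 *: (p + r) = o].

Definition configuration (R : realType) := {ffun 'I_6 -> 'rV[R]_2}.

Definition b1 : 'I_6 := @Ordinal 6 0 isT.
Definition b2 : 'I_6 := @Ordinal 6 1 isT.
Definition b3 : 'I_6 := @Ordinal 6 2 isT.
Definition b4 : 'I_6 := @Ordinal 6 3 isT.
Definition b5 : 'I_6 := @Ordinal 6 4 isT.
Definition b6 : 'I_6 := @Ordinal 6 5 isT.

Definition coord1 (R : realType) (u : 'rV[R]_2) : R := u 0 (@Ordinal 2 0 isT).
Definition coord2 (R : realType) (u : 'rV[R]_2) : R := u 0 (@Ordinal 2 1 isT).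

Definition dist (R : realType) (x : configuration R) (i j : 'I_6) : R :=
  enorm (x i - x j).

Definition total_vorticity (R : realType) (gamma : 'I_6 -> R) : R :=
  \sum_i gamma i.

Definition center (R : realType) (gamma : 'I_6 -> R) (x : configuration R) :
    'rV[R]_2 :=
  (total_vorticity gamma)^-1 *: \sum_i gamma i *: x i.

Definition central_configuration (R : realType) (gamma : 'I_6 -> R)
    (x : configuration R) : Prop :=
  [/\ forall i j, i != j -> x i != x j,
      forall i, gamma i != 0,
      total_vorticity gamma != 0
    & exists2 lambda : R, lambda != 0 & forall i,
        \sum_(j | j != i) (gamma j * dist x i j ^- 2) *: (x j - x i)
          + lambda *: (x i - center gamma x) = 0].

(* The equivalence says that the axis s := line p d carries exactly four of
   the points and that they are the ones indexed 1, 2, 3, 4. *)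
Definition CC6VP (R : realType) (gamma : 'I_6 -> R) (x : configuration R) :
    Prop :=
  [/\ central_configuration gamma x,
      ~ collinear (range x)
    & exists p d : 'rV[R]_2,
        [/\ d != 0,
            reflection p d @` range x = range x
          & forall i : 'I_6, line p d (x i) <-> i \in [:: b1; b2; b3; b4]]].

(* The line l is the one through x_5 and x_6; it is perpendicular to s because
   the reflection in s exchanges these two points. Being parallel to the first
   coordinate axis means that its direction x_6 - x_5 has second coordinate
   zero. *)
Definition X_V (R : realType) (gamma : 'I_6 -> R) (x : configuration R) :
    Prop :=
  [/\ CC6VP gamma x, center gamma x = 0, coord2 (x b6 - x b5) = 0
    & [/\ [/\ coord2 (x b1) > coord2 (x b2),
              coord2 (x b2) > coord2 (x b3)
            & coord2 (x b3) > coord2 (x b4)],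
          coord2 (x b5) > coord2 (x b3),
          coord2 (x b5) - coord2 (x b4) = 1
        & coord1 (x b5) < coord1 (x b1) /\ coord1 (x b1) < coord1 (x b6)]].

(* Main.v *)
Require Import Defs.
From mathcomp Require Import all_boot all_order all_algebra.
From mathcomp Require Import classical_sets reals.
From mathcomp Require Import ring lra.

Set Implicit Arguments.
Unset Strict Implicit.
Unset Printing Implicit Defensive.

Import Order.TTheory GRing.Theory Num.Theory.
Local Open Scope classical_set_scope.
Local Open Scope ring_scope.

(** The normalization leaves a one-parameter family of configurations: the
    points (0, 1), (0, a), (0, -a), (0, -1), (-a, 0), (a, 0) with 0 < a < 1.
    On this family the equations of motion reduce to three equations that are
    linear in lambda and in the common strength g of the bodies 5 and 6.
    Eliminating lambda and g leaves a quartic equation in t = a^2,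
      t^4 - 6 t^3 - 36 t^2 + 6 t + 3 = 0,
    with exactly one root in (0, 1): the quartic changes sign there, and its
    quotient by t is strictly decreasing. *)

(** * Coordinates, lines and centered squares in the plane *)

Section Plane.
Variable R : realType.
Implicit Types u v p d : 'rV[R]_2.

Definition pt (a b : R) : 'rV[R]_2 := \row_k (if val k == 0%N then a else b).

Lemma coord1_pt a b : coord1 (pt a b) = a.
Proof. by rewrite /coord1 mxE. Qed.

Lemma coord2_pt a b : coord2 (pt a b) = b.
Proof. by rewrite /coord2 mxE. Qed.

Lemma coordP u v : coord1 u = coord1 v -> coord2 u = coord2 v -> u = v.
Proof.
rewrite /coord1 /coord2 => e1 e2; apply/rowP => -[[|[|//]] lt].
- by rewrite (_ : Ordinal lt = Ordinal (isT : 0 < 2)%N) //; apply: val_inj.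
- by rewrite (_ : Ordinal lt = Ordinal (isT : 1 < 2)%N) //; apply: val_inj.
Qed.

Lemma coord1D u v : coord1 (u + v) = coord1 u + coord1 v.
Proof. by rewrite /coord1 mxE. Qed.

Lemma coord2D u v : coord2 (u + v) = coord2 u + coord2 v.
Proof. by rewrite /coord2 mxE. Qed.

Lemma coord1N u : coord1 (- u) = - coord1 u.
Proof. by rewrite /coord1 mxE. Qed.

Lemma coord2N u : coord2 (- u) = - coord2 u.
Proof. by rewrite /coord2 mxE. Qed.

Lemma coord1Z k u : coord1 (k *: u) = k * coord1 u.
Proof. by rewrite /coord1 mxE. Qed.

Lemma coord2Z k u : coord2 (k *: u) = k * coord2 u.
Proof. by rewrite /coord2 mxE. Qed.

Lemma coord1_0 : coord1 (0 : 'rV[R]_2) = 0.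
Proof. by rewrite /coord1 mxE. Qed.

Lemma coord2_0 : coord2 (0 : 'rV[R]_2) = 0.
Proof. by rewrite /coord2 mxE. Qed.

Definition coordE := (coord1D, coord2D, coord1N, coord2N, coord1Z, coord2Z,
  coord1_0, coord2_0, coord1_pt, coord2_pt).

Lemma dotE u v : dot u v = coord1 u * coord1 v + coord2 u * coord2 v.
Proof.
rewrite /dot !big_ord_recl big_ord0 addr0 /coord1 /coord2.
by congr (u 0 _ * v 0 _ + u 0 _ * v 0 _); apply: val_inj.
Qed.

Lemma sqr_enorm u : enorm u ^+ 2 = coord1 u ^+ 2 + coord2 u ^+ 2.
Proof. by rewrite sqr_sqrtr dotE -?expr2 // addr_ge0 ?sqr_ge0. Qed.

Lemma enorm_ge0 u : 0 <= enorm u.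
Proof. exact: sqrtr_ge0. Qed.

Lemma reflection_y_axis u :
  reflection 0 (pt 0 1) u = pt (- coord1 u) (coord2 u).
Proof.
by rewrite /reflection; apply: coordP; rewrite !(dotE, coordE); field.
Qed.

Lemma line_y_axis u : line 0 (pt 0 1) u <-> coord1 u = 0.
Proof.
split=> [[t ->]|u0]; first by rewrite !coordE; ring.
by exists (coord2 u); apply: coordP; rewrite !coordE ?u0; ring.
Qed.

(** Two points of the y-axis at different heights force the direction [d] to be vertical. This puts
    bodies 1 and 4 on the y-axis, and also refutes collinearity of a cross. *)
Lemma line_coord1_eq0 p d u v w : line p d u -> line p d v -> line p d w ->
  coord1 u = 0 -> coord1 v = 0 -> coord2 u != coord2 v -> coord1 w = 0.
Proof.
move=> [t ->] [s ->] [r ->]; rewrite !coordE => u0 v0 neq_uv.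
have /eqP : (t - s) * coord1 d = 0 by lra.
rewrite mulf_eq0 subr_eq0 => /orP[/eqP ets | /eqP d0].
  by rewrite ets eqxx in neq_uv.
by move: u0; rewrite d0 !mulr0.
Qed.

(** The center gives r = -p, the parallel sides then give s = -q, and the right angle at p becomes
    |p|^2 = |q|^2. This consequence does not depend on the unknown cyclic order of the vertices. *)
Lemma square_centered_at0_norm (V : set 'rV[R]_2) : square_centered_at 0 V ->
  exists rho, forall u, V u -> coord1 u ^+ 2 + coord2 u ^+ 2 = rho.
Proof.
move=> [p [q [r [s [-> [_ e_par e_dot _] e_mid]]]]].
exists (coord1 p ^+ 2 + coord2 p ^+ 2).
have r1 := congr1 (@coord1 R) e_mid; have r2 := congr1 (@coord2 R) e_mid.
have s1 := congr1 (@coord1 R) e_par; have s2 := congr1 (@coord2 R) e_par.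
move: r1 r2 s1 s2 e_dot; rewrite !(dotE, coordE) => r1 r2 s1 s2.
have -> : coord1 s = - coord1 q by lra.
have -> : coord2 s = - coord2 q by lra.
move=> e_dot u [[[|]|]|] ->; first by [].
- by lra.
- have -> : coord1 r = - coord1 p by lra.
  have -> : coord2 r = - coord2 p by lra.
  by rewrite !sqrrN.
- have -> : coord1 s = - coord1 q by lra.
  have -> : coord2 s = - coord2 q by lra.
  by rewrite !sqrrN; lra.
Qed.

End Plane.

(** * Six bodies and the forces on them *)

Section SixBodies.

Lemma ord6_ind (P : 'I_6 -> Prop) :
  P b1 -> P b2 -> P b3 -> P b4 -> P b5 -> P b6 -> forall i, P i.
Proof.
move=> P1 P2 P3 P4 P5 P6 [[|[|[|[|[|[|//]]]]]] lt].
- by rewrite (_ : Ordinal lt = b1) //; apply: val_inj.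
- by rewrite (_ : Ordinal lt = b2) //; apply: val_inj.
- by rewrite (_ : Ordinal lt = b3) //; apply: val_inj.
- by rewrite (_ : Ordinal lt = b4) //; apply: val_inj.
- by rewrite (_ : Ordinal lt = b5) //; apply: val_inj.
- by rewrite (_ : Ordinal lt = b6) //; apply: val_inj.
Qed.

Lemma sum_ord6 (V : nmodType) (F : 'I_6 -> V) :
  \sum_i F i = F b1 + (F b2 + (F b3 + (F b4 + (F b5 + F b6)))).
Proof.
rewrite !big_ord_recl big_ord0 addr0.
by repeat congr (_ + _); congr F; apply: val_inj.
Qed.

Variable R : realType.
Implicit Types (gamma : 'I_6 -> R) (x : configuration R).

(* The sum may include j = i: that term is a multiple of x i - x i = 0. *)
Definition force gamma x i : 'rV[R]_2 :=
  \sum_j (gamma j / (coord1 (x i - x j) ^+ 2 + coord2 (x i - x j) ^+ 2))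
    *: (x j - x i).

Lemma forceE gamma x i :
  \sum_(j | j != i) (gamma j * dist x i j ^- 2) *: (x j - x i)
    = force gamma x i.
Proof.
rewrite /force [RHS](bigD1 i) //= subrr scaler0 add0r.
by apply: eq_bigr => j _; rewrite /dist sqr_enorm.
Qed.

(** * The cross family and its equations of motion *)

Definition cross (a : R) : configuration R :=
  [ffun i => nth 0 [:: pt 0 1; pt 0 a; pt 0 (- a); pt 0 (- 1);
                       pt (- a) 0; pt a 0] (val i)].

Definition strengths (g : R) (i : 'I_6) : R := if (i < 4)%N then 1 else g.

Lemma cross1 a : cross a b1 = pt 0 1. Proof. by rewrite ffunE. Qed.
Lemma cross2 a : cross a b2 = pt 0 a. Proof. by rewrite ffunE. Qed.
Lemma cross3 a : cross a b3 = pt 0 (- a). Proof. by rewrite ffunE. Qed.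
Lemma cross4 a : cross a b4 = pt 0 (- 1). Proof. by rewrite ffunE. Qed.
Lemma cross5 a : cross a b5 = pt (- a) 0. Proof. by rewrite ffunE. Qed.
Lemma cross6 a : cross a b6 = pt a 0. Proof. by rewrite ffunE. Qed.

Definition crossE := (cross1, cross2, cross3, cross4, cross5, cross6).

(* The value of lambda imposed by the equation of motion of body i. *)
Definition multiplier (a g : R) (i : 'I_6) : R :=
  if (i == b1) || (i == b4) then
    2 / (1 - a ^+ 2) + 2^-1 + 2 * g / (1 + a ^+ 2)
  else if (i == b2) || (i == b3) then
    - 2 / (1 - a ^+ 2) + (2^-1 + g) / a ^+ 2
  else (g / 2 + 1) / a ^+ 2 + 2 / (1 + a ^+ 2).

(** Positions and strengths are symmetric in both axes, so the force on a body lies along the axis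
    carrying it. The vector equations thus become equalities between scalars. *)
Lemma force_cross (a g : R) i : 0 < a -> a < 1 ->
  force (strengths g) (cross a) i = - multiplier a g i *: cross a i.
Proof.
move=> a_gt0 a_lt1.
have a2_gt0 : 0 < a ^+ 2 by rewrite exprn_gt0.
have a2_lt1 : a ^+ 2 < 1 by rewrite expr_lt1 // ltW.
move: i; apply: ord6_ind;
  rewrite /force sum_ord6 !crossE /strengths !(subrr, scaler0) /multiplier /=;
  apply: coordP; rewrite !coordE; field;
  repeat (apply/andP; split); rewrite ?sqrrN ?opprK;
  first [exact: lt0r_neq0 | apply: lt0r_neq0; lra | apply: ltr0_neq0; lra].
Qed.

(** * Elimination of lambda and g, and the root of the quartic *)

Definition quartic (t : R) : R :=
  t ^+ 4 - 6 * t ^+ 3 - 36 * t ^+ 2 + 6 * t + 3.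

Lemma quartic_of_multiplier (a g lambda : R) : 0 < a -> a < 1 ->
  (forall i, multiplier a g i = lambda) -> quartic (a ^+ 2) = 0.
Proof.
move=> a_gt0 a_lt1 e_lambda.
have := e_lambda b1; have := e_lambda b2; have := e_lambda b6.
rewrite /multiplier /=.
have: 0 < a ^+ 2 by rewrite exprn_gt0.
have: a ^+ 2 < 1 by rewrite expr_lt1 // ltW.
rewrite /quartic; move: (a ^+ 2) => t t_lt1 t_gt0 <- e26 e16.
have t_neq0 : t != 0 by rewrite gt_eqF.
have Dt_neq0 : 1 + t != 0 by apply: lt0r_neq0; lra.
have Bt_neq0 : 1 - t != 0 by apply: lt0r_neq0; lra.
(* Bodies 2 and 6 have the same multiplier; this is linear in [g]. *)
have e_g : g * (1 - t ^+ 2) = 1 - t ^+ 2 + 8 * t.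
  have -> : g = (g / 2) * 2 by field.
  have -> : g / 2 = t * (1 / (2 * t) + 2 / (1 - t) + 2 / (1 + t)).
    have -> : g / 2 = t * ((2^-1 + g) / t - (g / 2 + 1) / t) + 2^-1 by field.
    have -> : (2^-1 + g) / t - (g / 2 + 1) / t = 2 / (1 - t) + 2 / (1 + t).
      by lra.
    by field; rewrite t_neq0 Dt_neq0 Bt_neq0.
  by field; rewrite t_neq0 Dt_neq0 Bt_neq0.
(* Bodies 1 and 6, with denominators cleared, give a second linear equation in [g]. *)
have e_g1 : g * (3 * t - 1) * (1 - t) = (1 - t ^+ 2) * (2 - t) - 8 * t ^+ 2.
  have : 2 * t * (1 + t) * (1 - t) * (2 / (1 - t) + 2^-1 + 2 * g / (1 + t)) =
         2 * t * (1 + t) * (1 - t) * ((g / 2 + 1) / t + 2 / (1 + t)).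
    by rewrite e16.
  have -> : 2 * t * (1 + t) * (1 - t) * (2 / (1 - t) + 2^-1 + 2 * g / (1 + t)) =
     2 * t * (1 + t) * 2 + t * (1 + t) * (1 - t) + 4 * t * (1 - t) * g.
    by field; rewrite Dt_neq0 Bt_neq0.
  have -> : 2 * t * (1 + t) * (1 - t) * ((g / 2 + 1) / t + 2 / (1 + t)) =
     (1 + t) * (1 - t) * (g + 2) + 4 * t * (1 - t).
    by field; rewrite Dt_neq0 t_neq0.
  by move=> e; lra.
(* Both sides equal g (3t - 1)(1 - t^2). Cross-multiplying avoids a division by 3t - 1, which
   vanishes at t = 1/3. *)
have : (1 + t) * ((1 - t ^+ 2) * (2 - t) - 8 * t ^+ 2) =
       (1 - t ^+ 2 + 8 * t) * (3 * t - 1).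
  by rewrite -e_g1 -e_g; ring.
by move=> e; lra.
Qed.

(** The solution g of the equation between bodies 2 and 6. *)
Definition cross_strength (a : R) : R := 1 + 8 * a ^+ 2 / (1 - a ^+ 4).

(** This strength makes bodies 2 and 6 agree for every a in (0, 1). The multipliers of bodies 6 and
    1 then differ by the quartic over a nonzero denominator. *)
Lemma multiplier_of_quartic (a : R) i : 0 < a -> a < 1 -> quartic (a ^+ 2) = 0 ->
  multiplier a (cross_strength a) i = multiplier a (cross_strength a) b1.
Proof.
move=> a_gt0 a_lt1.
have: 0 < a ^+ 2 by rewrite exprn_gt0.
have: a ^+ 2 < 1 by rewrite expr_lt1 // ltW.
rewrite /multiplier /cross_strength /= (exprM a 2 2) /quartic.
move: (a ^+ 2) => t t_lt1 t_gt0 q0.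
have t_neq0 : t != 0 by rewrite gt_eqF.
have Dt_neq0 : 1 + t != 0 by apply: lt0r_neq0; lra.
have Bt_neq0 : 1 - t != 0 by apply: lt0r_neq0; lra.
have t2_lt1 : t ^+ 2 < 1 by rewrite expr_lt1 // ltW.
have Bt2_neq0 : 1 - t ^+ 2 != 0 by rewrite lt0r_neq0 // subr_gt0.
have e26 : - 2 / (1 - t) + (2^-1 + (1 + 8 * t / (1 - t ^+ 2))) / t
           = ((1 + 8 * t / (1 - t ^+ 2)) / 2 + 1) / t + 2 / (1 + t).
  by field; rewrite t_neq0 Dt_neq0 Bt_neq0 Bt2_neq0.
have e16 : ((1 + 8 * t / (1 - t ^+ 2)) / 2 + 1) / t + 2 / (1 + t)
           = 2 / (1 - t) + 2^-1 + 2 * (1 + 8 * t / (1 - t ^+ 2)) / (1 + t).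
  apply/eqP; rewrite -subr_eq0; apply/eqP.
  rewrite [LHS](_ : _ =
    (t ^+ 4 - 6 * t ^+ 3 - 36 * t ^+ 2 + 6 * t + 3) /
    (2 * t * (1 + t) * (1 - t ^+ 2))); first by rewrite q0 mul0r.
  by field; rewrite t_neq0 Dt_neq0 Bt_neq0 Bt2_neq0.
by case: ifP => // _; case: ifP => // _; rewrite e26.
Qed.

Lemma quartic_has_root : exists t : R, [/\ 0 < t, t < 1 & quartic t = 0].
Proof.
(* The quartic is 3 at 0 and -32 at 1; [poly_ivt] wants a change from negative to positive, hence
   the opposite sign. Its root lies in a closed interval, whose ends are excluded below. *)
pose p : {poly R} := - 'X^4 + 6 *: 'X^3 + 36 *: 'X^2 - 6 *: 'X - 3%:P.
have pE t : p.[t] = - quartic t.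
  rewrite /p /quartic.
  by rewrite !(hornerD, hornerN, hornerZ, hornerXn, hornerX, hornerC); ring.
have [|t /andP[t0 t1]] := @poly_ivt _ p 0 1 ler01.
  by rewrite !pE /quartic; apply/andP; split; lra.
rewrite /root pE oppr_eq0 => /eqP q0; exists t; split=> //.
- rewrite lt_neqAle t0 andbT; apply/eqP => e.
  by move: q0; rewrite -e /quartic; lra.
- rewrite lt_neqAle t1 andbT; apply/eqP => e.
  by move: q0; rewrite e /quartic; lra.
Qed.

Lemma quartic_root_unique (s t : R) : 0 < s -> s < 1 -> 0 < t -> t < 1 ->
  quartic s = 0 -> quartic t = 0 -> s = t.
Proof.
rewrite /quartic => s_gt0 s_lt1 t_gt0 t_lt1 qs qt.
apply/eqP; rewrite -subr_eq0.
(* This is s [quartic t] - t [quartic s], the difference of the quotients by t and by s with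
   denominators cleared. Its second factor is positive on the unit square. *)
have /eqP : (s - t) * (3 + 36 * (s * t) +
    (s * t) * (6 * (s + t) - s ^+ 2 - s * t - t ^+ 2)) = 0.
  have := congr1 ( *%R s) qt; have := congr1 ( *%R t) qs; rewrite !mulr0.
  by move=> e1 e2; lra.
rewrite mulf_eq0 => /orP[//|/eqP e].
have st_gt0 : 0 < s * t by rewrite mulr_gt0.
suff : 0 < (s * t) * (6 * (s + t) - s ^+ 2 - s * t - t ^+ 2) by lra.
by rewrite mulr_gt0 //; nra.
Qed.

(** * Existence: the cross with a root of the quartic satisfies all conditions *)

Lemma cross_inj (a : R) : 0 < a -> a < 1 -> injective (cross a).
Proof.
move=> a_gt0 a_lt1; apply: ord6_ind; apply: ord6_ind => //; rewrite !crossE => e;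
  exfalso; move: (congr1 (@coord1 R) e) (congr1 (@coord2 R) e);
  rewrite !coordE; lra.
Qed.

Lemma X_V_cross (a : R) : 0 < a -> a < 1 -> quartic (a ^+ 2) = 0 ->
  X_V (strengths (cross_strength a)) (cross a).
Proof.
move=> a_gt0 a_lt1 q0; set g := cross_strength a.
have a2_gt0 : 0 < a ^+ 2 by rewrite exprn_gt0.
have a2_lt1 : a ^+ 2 < 1 by rewrite expr_lt1 // ltW.
have a4_lt1 : a ^+ 4 < 1 by rewrite expr_lt1 // ltW.
have g_gt0 : 0 < g.
  by rewrite addr_gt0 // divr_gt0 ?mulr_gt0 // subr_gt0.
have c0 : center (strengths g) (cross a) = 0.
  rewrite /center sum_ord6 !crossE /strengths /=.
  by apply: coordP; rewrite !coordE; ring.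
split=> //; last 2 first.
- by rewrite !crossE !coordE; lra.
- by rewrite !crossE !coordE; split; [split| | |]; lra.
split.
- split.
  + by move=> i j; apply: contra_neq; exact: cross_inj.
  + by move=> i; rewrite /strengths; case: ifP => _; rewrite lt0r_neq0.
  + by apply: lt0r_neq0; rewrite /total_vorticity sum_ord6 /strengths /=; lra.
  (* Since g > 0, this multiplier is a sum of positive terms. *)
  + exists (multiplier a g b1).
      rewrite /multiplier /=; apply: lt0r_neq0.
      have : 0 < 2 / (1 - a ^+ 2) by apply: divr_gt0; lra.
      have : 0 < 2 * g / (1 + a ^+ 2) by apply: divr_gt0; lra.
      by lra.
    move=> i; rewrite forceE force_cross // c0 subr0 multiplier_of_quartic //.
    by rewrite scaleNr addNr.
(* A line through bodies 1 and 4 is the y-axis, which misses body 6. *)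
- move=> [p [d [_ col]]].
  have on i : line p d (cross a i) by apply: col; exists i.
  have := line_coord1_eq0 (on b1) (on b4) (on b6).
  rewrite !crossE !coordE => /(_ erefl erefl) a0.
  suff : a = 0 by lra.
  by apply: a0; rewrite gt_eqF //; lra.
- exists 0, (pt 0 1); split.
  + by apply/eqP => /(congr1 (@coord2 R)); rewrite !coordE; lra.
  + have refl i : exists j, reflection 0 (pt 0 1) (cross a i) = cross a j.
      move: i; apply: ord6_ind; rewrite reflection_y_axis !crossE !coordE.
      * by exists b1; rewrite crossE oppr0.
      * by exists b2; rewrite crossE oppr0.
      * by exists b3; rewrite crossE oppr0.
      * by exists b4; rewrite crossE oppr0.
      * by exists b6; rewrite crossE opprK.
      * by exists b5; rewrite crossE.
    (* Involutivity turns the inclusion of the reflected set into an equality. *)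
    have reflK u : reflection 0 (pt 0 1) (reflection 0 (pt 0 1) u) = u :> 'rV[R]_2.
      by rewrite !reflection_y_axis; apply: coordP; rewrite !coordE ?opprK.
    apply/seteqP; split=> [_ [_ [i _ <-] <-]|_ [i _ <-]].
      by have [j ->] := refl i; exists j.
    have [j ej] := refl i; exists (cross a j); first by exists j.
    by rewrite -ej reflK.
  + apply: ord6_ind; rewrite line_y_axis !crossE !coordE; split=> //; lra.
Qed.

Lemma cross_square (a : R) : 0 < a ->
  square_centered_at 0 [set cross a b2; cross a b3; cross a b5; cross a b6].
Proof.
(* The diagonals join 2 to 3 and 5 to 6, so the cyclic order is 2, 5, 3, 6. *)
move=> a_gt0; exists (cross a b2), (cross a b5), (cross a b3), (cross a b6).
rewrite !crossE; split.
- by rewrite -!setUA; congr (_ `|` _); rewrite setUCA.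
- split.
  + apply/eqP => /(congr1 (@coord1 R)); rewrite !coordE; lra.
  + by apply: coordP; rewrite !coordE; ring.
  + by rewrite dotE !coordE; ring.
  + by rewrite /enorm !dotE !coordE; congr Num.sqrt; ring.
- by apply: coordP; rewrite !coordE; ring.
Qed.

(** * Uniqueness: the conditions force a cross, and its parameter solves the quartic *)

Lemma cross_of_conditions gamma x : X_V gamma x ->
  square_centered_at 0 [set x b2; x b3; x b5; x b6] ->
  coord1 (x b2) = 0 -> coord1 (x b3) = 0 ->
  coord2 (x b5) = 0 -> coord2 (x b6) = 0 -> dist x b1 b4 = 2 ->
  exists a, [/\ 0 < a, a < 1 & x = cross a].
Proof.
move=> [[_ _ [p [d [_ _ axis]]]] _ _ [[lt21 lt32 lt43] lt35 e54 [lt51 lt16]]].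
move=> /square_centered_at0_norm [rho sq] x21 x31 x52 x62 d14.
have on (i : 'I_6) : (i < 4)%N -> line p d (x i).
  by move=> lti; apply/axis; move: i lti; apply: ord6_ind.
have neq23 : coord2 (x b2) != coord2 (x b3) by rewrite gt_eqF.
have x11 : coord1 (x b1) = 0.
  by apply: (line_coord1_eq0 (on b2 _) (on b3 _) (on b1 _)).
have x41 : coord1 (x b4) = 0.
  by apply: (line_coord1_eq0 (on b2 _) (on b3 _) (on b4 _)).
have x42 : coord2 (x b4) = -1 by lra.
have x12 : coord2 (x b1) = 1.
  have : enorm (x b1 - x b4) ^+ 2 = 2 ^+ 2 by rewrite -d14.
  rewrite sqr_enorm !coordE x11 x41 x42 subrr expr0n add0r opprK.
  (* The other sign would put body 1 at height -3, below body 4. *)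
  by move=> /eqP; rewrite eqf_sqr => /orP[] /eqP e; lra.
have n2 : coord2 (x b2) ^+ 2 = rho.
  by rewrite -(sq (x b2)) ?x21 ?expr0n ?add0r //; left; left; left.
have n3 : coord2 (x b3) ^+ 2 = coord2 (x b2) ^+ 2.
  by rewrite n2 -(sq (x b3)) ?x31 ?expr0n ?add0r //; left; left; right.
have n5 : coord1 (x b5) ^+ 2 = coord2 (x b2) ^+ 2.
  by rewrite n2 -(sq (x b5)) ?x52 ?expr0n ?addr0 //; left; right.
have n6 : coord1 (x b6) ^+ 2 = coord2 (x b2) ^+ 2.
  by rewrite n2 -(sq (x b6)) ?x62 ?expr0n ?addr0 //; right.
(* The square fixes these coordinates up to sign. The orderings choose the signs: body 3 is below
   both body 2 and height 0, and bodies 5 and 6 are on either side of the y-axis. *)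
have {n3} x32 : coord2 (x b3) = - coord2 (x b2).
  by move/eqP: n3; rewrite eqf_sqr => /orP[] /eqP e //; lra.
have x51 : coord1 (x b5) = - coord2 (x b2).
  by move/eqP: n5; rewrite eqf_sqr => /orP[] /eqP e //; lra.
have x61 : coord1 (x b6) = coord2 (x b2).
  by move/eqP: n6; rewrite eqf_sqr => /orP[] /eqP e //; lra.
exists (coord2 (x b2)); split; [by lra..|].
by apply/ffunP; apply: ord6_ind; rewrite crossE; apply: coordP; rewrite !coordE.
Qed.

Lemma cross_central_quartic gamma (a : R) : 0 < a -> a < 1 ->
  gamma b1 = 1 -> gamma b2 = 1 -> gamma b3 = 1 -> gamma b4 = 1 ->
  gamma b5 = gamma b6 -> central_configuration gamma (cross a) ->
  center gamma (cross a) = 0 -> quartic (a ^+ 2) = 0.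
Proof.
move=> a_gt0 a_lt1 g1 g2 g3 g4 g56 [_ _ _ [lambda _ eqs]] c0.
have gE j : gamma j = strengths (gamma b5) j.
  by move: j; apply: ord6_ind.
apply: (@quartic_of_multiplier a (gamma b5) lambda) => // i.
have := eqs i; rewrite c0 subr0 forceE.
have -> : force gamma (cross a) i = force (strengths (gamma b5)) (cross a) i.
  by apply: eq_bigr => j _; rewrite gE.
rewrite force_cross // -scalerDl => /eqP; rewrite scaler_eq0 addrC subr_eq0.
(* No body of a cross sits at the origin, so the scalar factor must vanish. *)
case/orP => /eqP // xi0; exfalso.
move: i {eqs} xi0; apply: ord6_ind; rewrite !crossE => e;
  move: (congr1 (@coord1 R) e) (congr1 (@coord2 R) e); rewrite !coordE; lra.
Qed.
End SixBodies.

Theorem proposition8p3 (R : realType) :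
  exists! x : configuration R,
    (exists gamma : 'I_6 -> R,
       [/\ gamma b1 = 1 /\ gamma b2 = 1, gamma b3 = 1 /\ gamma b4 = 1,
           gamma b5 = gamma b6 & X_V gamma x])
    /\ [/\ collinear [set x b1; x b2; x b3; x b4],
           [/\ square_centered_at 0 [set x b2; x b3; x b5; x b6],
               coord1 (x b2) = 0 /\ coord1 (x b3) = 0
             & coord2 (x b5) = 0 /\ coord2 (x b6) = 0]
         & dist x b1 b2 = dist x b3 b4 /\ dist x b1 b4 = 2].
Proof.
have [t [t_gt0 t_lt1 qt]] := quartic_has_root R.
pose a := Num.sqrt t.
have a_gt0 : 0 < a by rewrite sqrtr_gt0.
have a2 : a ^+ 2 = t by rewrite sqr_sqrtr // ltW.
have a_lt1 : a < 1 by rewrite -(@expr_lt1 _ 2) ?a2 // ltW.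
exists (cross a); split.
  split.
    exists (strengths (cross_strength a)); split=> //.
    by apply: X_V_cross; rewrite ?a2.
  split.
  - exists 0, (pt 0 1); split.
      by apply/eqP => /(congr1 (@coord2 R)); rewrite !coordE; lra.
    by move=> u [[[|]|]|] ->; rewrite line_y_axis !crossE !coordE.
  - by split; [exact: cross_square|split..]; rewrite !crossE !coordE.
  - split.
      by rewrite /dist /enorm !dotE !crossE !coordE; congr Num.sqrt; ring.
    apply/eqP; rewrite -(@eqrXn2 _ 2) ?enorm_ge0 // sqr_enorm !crossE !coordE.
    by apply/eqP; ring.
move=> y [[gamma [[g1 g2] [g3 g4] g56 Xy]] [_ [sq [y21 y31] [y52 y62]] [_ d14]]].
have [b [b_gt0 b_lt1 yE]] := cross_of_conditions Xy sq y21 y31 y52 y62 d14.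
case: Xy => [[central _ _] c0 _ _]; rewrite yE in central c0 *.
have qb := cross_central_quartic b_gt0 b_lt1 g1 g2 g3 g4 g56 central c0.
(* Both parameters are positive, so it is enough to compare their squares, which are roots of the
   quartic in (0, 1). *)
congr cross; apply/eqP; rewrite -(@eqrXn2 _ 2) ?ltW // a2; apply/eqP.
by apply: quartic_root_unique; rewrite ?exprn_gt0 ?expr_lt1 // ltW.
Qed.
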